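(* Let $X$ be a scheme over a field $K$. Suppose that $k\ge1$ and that $(k+2)!$ is not divisible by the characteristic of $K$. Let $E$ be a locally free sheaf (of finite rank $M$) over $X$, $\mathcal U=\{U_i\}_{i\in I}$ a Zariski open cover of $X$ ($I$ an ordered set), and $g=\{g_{ij}\}$ a system of transition functions associated with a certain trivialization of $E$ with respect to $\mathcal U$. For any indices $i_1,\dots,i_{k+1}\in I$ define $t_{i_1\cdots i_{k+1}}\in\Gamma(U_{i_1\cdots i_{k+1}},\Omega^k)$ by $$t_{i_1\cdots i_{k+1}}:=\sum_{\sigma\in S_{k+1}}\frac{\mathrm{sgn}(\sigma)}{(k+1)!}\,\mathrm{tr}\Big(\prod_{l=1}^{k} g^{-1}_{i_{\sigma(l)}i_{\sigma(k+1)}}dg_{i_{\sigma(l)}i_{\sigma(k+1)}}\Big)$$ (factors ordered $l=1,\dots,k$ from left to right), and define the Čech $k$-cochain $\widehat f_{k,\mathcal U}(E):=(t_{i_1\cdots i_{k+1}})_{i_1<\cdots<i_{k+1}}$ with coefficients in $\Omega^k$. Then $\widehat f_{k,\mathcal U}(E)$ is a Čech $k$-cocycle and hence defines an element $f_{k,\mathcal U}(E)\in\check H^k(\mathcal U,\Omega^k)$; moreover, $f_{k,\mathcal U}(E)$ is independent of the choice of $g$. Denote by $f_k(E)$ the image of $f_{k,\mathcal U}(E)$ in $\check H^k(X,\Omega^k)$ under the canonical homomorphism. Then $f_k(E)$ is independent of the choice of $\mathcal U$.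
   Context: $\Omega_{X/\mathrm{Spec}\,K}$ is the sheaf of Kähler differentials of $X$ over $\mathrm{Spec}\,K$ and $\Omega^k$ is its $k$-th exterior power sheaf. A trivialization of $E$ with respect to $\mathcal U$ is a family of isomorphisms $\phi_i:E|_{U_i}\to\mathcal O_{U_i}^{M}$; its transition functions are $g_{ij}=\phi_i\circ\phi_j^{-1}\in GL_M(\mathcal O_X(U_i\cap U_j))$. $U_{i_1\cdots i_p}=U_{i_1}\cap\cdots\cap U_{i_p}$. $dg_{ij}$ is the entrywise Kähler differential; products are matrix products with entries multiplied in the exterior algebra. Čech $k$-cochains are families of sections indexed by $i_1<\cdots<i_{k+1}$ with differential $(\partial s)_{i_1\cdots i_{k+2}}=\sum_j(-1)^{j+1}s_{i_1\cdots\widehat{i_j}\cdots i_{k+2}}$; $\check H^k(\mathcal U,\cdot)$ is the resulting cohomology and $\check H^k(X,\cdot)=\varinjlim_{\mathcal U}\check H^k(\mathcal U,\cdot)$ over Zariski open covers under refinement. In characteristic $0$ the divisibility hypothesis is automatically satisfied. $f_k(E)$ is called the $k$-th $T$ invariant of $E$. *)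

(* Defs.v *)
From HB Require Import structures.
From mathcomp Require Import all_boot all_order all_algebra all_fingroup.
From mathcomp Require Import all_classical topology.
From Stdlib Require Import Relation_Operators.

Set Implicit Arguments.
Unset Strict Implicit.
Unset Printing Implicit Defensive.
Import Order.TTheory GRing.Theory.
Local Open Scope classical_set_scope.
Local Open Scope ring_scope.

Record opens (X : topologicalType) := Opens {
  oset :> set X;
  oset_open : open oset }.

Definition opens_setT (X : topologicalType) : opens X := Opens openT.

Definition opens_setI (X : topologicalType) (U V : opens X) : opens X :=
  Opens (openI (oset_open U) (oset_open V)).

Lemma open_fin_bigcap (X : topologicalType) (n : nat) (U : 'I_n -> opens X) :
  open (\bigcap_l (U l : set X)).
Proof.
rewrite openE => x Ux; rewrite /interior.
have H : \forall y \near x, forall l, (U l : set X) y.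
  apply: filter_forall => l; apply: open_nbhs_nbhs.
  by split; [exact: oset_open | exact: Ux].
by apply: filterS H => y Hy l _; exact: Hy.
Qed.

Definition opens_bigcap (X : topologicalType) (n : nat) (U : 'I_n -> opens X) :
  opens X := Opens (open_fin_bigcap U).

Definition is_presheaf (X : topologicalType) (F : opens X -> Type)
    (res : forall U V : opens X, V `<=` U -> F U -> F V) : Prop :=
  (forall (U : opens X) (h : U `<=` U) s, res U U h s = s) /\
  (forall (U V W : opens X) (hVU : V `<=` U) (hWV : W `<=` V) (hWU : W `<=` U) s,
     res V W hWV (res U V hVU s) = res U W hWU s).

Definition is_sheaf (X : topologicalType) (F : opens X -> Type)
    (res : forall U V : opens X, V `<=` U -> F U -> F V) : Prop :=
  is_presheaf res /\
  forall (J : Type) (U : opens X) (V : J -> opens X) (hV : forall j, V j `<=` U)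
    (s : forall j, F (V j)),
    (oset U `<=` \bigcup_j (V j : set X)) ->
    (forall i j (W : opens X) (hi : W `<=` V i) (hj : W `<=` V j),
       res (V i) W hi (s i) = res (V j) W hj (s j)) ->
    exists! t : F U, forall j, res U (V j) (hV j) t = s j.

(* Rings of sections are [comPzRingType]s: the ring over the empty set is 0. *)
Record ring_sheaf (X : topologicalType) := RingSheaf {
  rsec :> opens X -> comPzRingType;
  rres : forall U V : opens X, V `<=` U -> {rmorphism rsec U -> rsec V};
  rsheaf : is_sheaf (fun U V h => rres h : rsec U -> rsec V) }.

Record mod_sheaf (X : topologicalType) (O : ring_sheaf X) := ModSheaf {
  msec :> forall U : opens X, lmodType (O U);
  mres : forall U V : opens X, V `<=` U -> {additive msec U -> msec V};
  mresZ : forall (U V : opens X) (h : V `<=` U) (a : O U) (s : msec U),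
    mres h (a *: s) = rres O h a *: mres h s;
  msheaf : is_sheaf (fun U V h => mres h : msec U -> msec V) }.

(* Sheaves of associative unital O-algebras.  The library's [algType] excludes
   the zero ring, so the algebra structure is a central ring morphism. *)
Record alg_sheaf (X : topologicalType) (O : ring_sheaf X) := AlgSheaf {
  asec :> opens X -> pzRingType;
  ares : forall U V : opens X, V `<=` U -> {rmorphism asec U -> asec V};
  ain : forall U : opens X, {rmorphism O U -> asec U};
  ain_central : forall (U : opens X) (a : O U) (s : asec U),
    ain U a * s = s * ain U a;
  ain_res : forall (U V : opens X) (h : V `<=` U) (a : O U),
    ares h (ain U a) = ain V (rres O h a);
  asheaf : is_sheaf (fun U V h => ares h : asec U -> asec V) }.

Record ab_presheaf (X : topologicalType) := AbPresheaf {
  absec :> opens X -> zmodType;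
  abres : forall U V : opens X, V `<=` U -> {additive absec U -> absec V};
  abpresheaf : is_presheaf (fun U V h => abres h : absec U -> absec V) }.

Record spec (R : comPzRingType) := Spec {
  prime_set :> set R;
  prime0 : prime_set 0;
  primeD : forall a b, prime_set a -> prime_set b -> prime_set (a + b);
  primeM : forall a b, prime_set b -> prime_set (a * b);
  prime1 : ~ prime_set 1;
  prime_prime : forall a b,
    prime_set (a * b) -> prime_set a \/ prime_set b }.

Section Zariski.
Variable R : comPzRingType.

HB.instance Definition _ := gen_eqMixin (spec R).
HB.instance Definition _ := gen_choiceMixin (spec R).

Definition zariski_open : set_system (spec R) :=
  [set S | exists I : set R, S = [set p : spec R | ~ (I `<=` p)]].

Let zariskiT : zariski_open setT.
Proof.
exists [set 1]; apply/seteqP; split=> // p _ /= H.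
by apply: (@prime1 _ p); exact: H.
Qed.

Let zariskiI : setI_closed zariski_open.
Proof.
move=> _ _ [I ->] [J ->].
exists [set x | exists a b, [/\ I a, J b & x = a * b]].
apply/seteqP; split=> p /=.
  move=> [pI pJ] pIJ.
  have [a [Ia pa]] : exists a, I a /\ ~ prime_set p a.
    by apply: contrapT => H; apply: pI => a Ia; apply: contrapT => pa;
       apply: H; exists a.
  have [b [Jb pb]] : exists b, J b /\ ~ prime_set p b.
    by apply: contrapT => H; apply: pJ => b Jb; apply: contrapT => pb;
       apply: H; exists b.
  have : prime_set p (a * b) by apply: pIJ; exists a, b.
  by move=> /prime_prime[].
move=> pIJ; split=> pX; apply: pIJ => _ [a [b [Ia Jb ->]]].
  by rewrite mulrC; apply: primeM; exact: pX.
by apply: primeM; exact: pX.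
Qed.

Let zariski_bigU (J : Type) (f : J -> set (spec R)) :
  (forall j, zariski_open (f j)) -> zariski_open (\bigcup_j f j).
Proof.
move=> fo; pose I j := sval (cid (fo j)).
have fE j : f j = [set p : spec R | ~ (I j `<=` p)] by exact: (svalP (cid (fo j))).
exists (\bigcup_j I j); apply/seteqP; split=> p /=.
  by move=> [j _]; rewrite fE /= => pI H; apply: pI => x Ix; apply: H; exists j.
move=> H; apply: contrapT => nf; apply: H => x [j _ Ix].
apply: contrapT => px; apply: nf; exists j => //; rewrite fE /= => pI.
exact/px/pI.
Qed.

HB.instance Definition _ :=
  isOpenTopological.Build (spec R) zariskiT zariskiI zariski_bigU.

Definition basic_open (f : R) : set (spec R) := [set p : spec R | ~ prime_set p f].

End Zariski.

(* theta exhibits A as the localization R_f. *)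
Definition is_localization_away (R A : comPzRingType) (f : R) (theta : R -> A) :=
  [/\ exists u, theta f * u = 1,
      forall a : A, exists (n : nat) (r : R), theta (f ^+ n) * a = theta r &
      forall r : R, theta r = 0 -> exists n : nat, f ^+ n * r = 0].

(* (V, O|_V) is isomorphic to Spec R as a ringed space: psi is a homeomorphism
   from Spec R onto V, and the isomorphism of sheaves is given on the basis of
   the D(f), where the structure sheaf of Spec R has sections R_f and
   restriction maps commuting with R -> R_f. *)
Definition affine_iso (X : topologicalType) (O : ring_sheaf X) (V : opens X)
    (R : comPzRingType) (psi : spec R -> X) (theta : {rmorphism R -> O V}) :=
  [/\ range psi = V, injective psi, continuous psi,
      forall S : set (spec R), open S -> open (psi @` S) &
      forall (f : R) (W : opens X) (h : W `<=` V),
        psi @` basic_open f = W ->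
        is_localization_away f (fun r => rres O h (theta r))].

Definition is_scheme (X : topologicalType) (O : ring_sheaf X) : Prop :=
  forall x : X, exists (V : opens X) (R : comPzRingType) (psi : spec R -> X)
    (theta : {rmorphism R -> O V}), (V : set X) x /\ affine_iso psi theta.

(* A morphism X -> Spec K is a ring morphism K -> O_X(X), as the space Spec K
   is a point, with sections K. *)
Record scheme_over (K : fieldType) := SchemeOver {
  sch_space :> topologicalType;
  sch_O : ring_sheaf sch_space;
  sch_schemeP : is_scheme sch_O;
  sch_str : {rmorphism K -> sch_O (opens_setT sch_space)} }.

Definition const_sec (K : fieldType) (X : scheme_over K) (U : opens X) (c : K) :
  sch_O X U := @rres _ (sch_O X) (opens_setT X) U (@subsetT X U) (sch_str X c).

Definition is_mod_hom (X : topologicalType) (O : ring_sheaf X)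
    (F G : mod_sheaf O) (h : forall U, F U -> G U) : Prop :=
  (forall U (a : O U) (s t : F U), h U (a *: s + t) = a *: h U s + h U t) /\
  (forall (U V : opens X) (i : V `<=` U) (s : F U),
     mres G i (h U s) = h V (mres F i s)).

Definition is_derivation (K : fieldType) (X : scheme_over K)
    (F : mod_sheaf (sch_O X)) (D : forall U, sch_O X U -> F U) : Prop :=
  [/\ forall U (a b : sch_O X U), D U (a + b) = D U a + D U b,
      forall U (a b : sch_O X U), D U (a * b) = a *: D U b + b *: D U a,
      forall U (c : K), D U (const_sec U c) = 0 &
      forall (U V : opens X) (i : V `<=` U) (a : sch_O X U),
        mres F i (D U a) = D V (rres (sch_O X) i a)].

(* Omega_{X/Spec K}, with d, as the O_X-module representing K-derivations of
   O_X into O_X-modules; it is unique up to unique isomorphism. *)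
Record kaehler (K : fieldType) (X : scheme_over K) := Kaehler {
  omega :> mod_sheaf (sch_O X);
  dK : forall U, sch_O X U -> omega U;
  dK_derivation : is_derivation dK;
  dK_universal : forall (F : mod_sheaf (sch_O X))
    (D : forall U, sch_O X U -> F U), is_derivation D ->
    exists! h : forall U, omega U -> F U,
      is_mod_hom h /\ forall U a, h U (dK a) = D U a }.

Definition is_alg_hom (X : topologicalType) (O : ring_sheaf X)
    (A B : alg_sheaf O) (h : forall U, A U -> B U) : Prop :=
  [/\ forall U (s t : A U), h U (s + t) = h U s + h U t,
      forall U (s t : A U), h U (s * t) = h U s * h U t,
      forall U (a : O U), h U (ain A U a) = ain B U a &
      forall (U V : opens X) (i : V `<=` U) (s : A U),
        ares B i (h U s) = h V (ares A i s)].

Definition is_wedge_map (X : topologicalType) (O : ring_sheaf X)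
    (F : mod_sheaf O) (A : alg_sheaf O) (j : forall U, F U -> A U) : Prop :=
  [/\ forall U (a : O U) (s t : F U), j U (a *: s + t) = ain A U a * j U s + j U t,
      forall U (s : F U), j U s * j U s = 0 &
      forall (U V : opens X) (i : V `<=` U) (s : F U),
        ares A i (j U s) = j V (mres F i s)].

(* The sheaf of exterior algebras of F, i.e. the sheaf associated with
   U |-> Lambda_{O(U)} F(U), given by its universal property. *)
Record exterior_algebra (X : topologicalType) (O : ring_sheaf X)
    (F : mod_sheaf O) := ExteriorAlgebra {
  ext_alg :> alg_sheaf O;
  ext_in : forall U, F U -> ext_alg U;
  ext_in_wedge : is_wedge_map ext_in;
  ext_universal : forall (B : alg_sheaf O) (j : forall U, F U -> B U),
    is_wedge_map j ->
    exists! h : forall U, ext_alg U -> B U,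
      is_alg_hom h /\ forall U s, h U (ext_in s) = j U s }.

Section ExteriorPower.
Variables (X : topologicalType) (O : ring_sheaf X) (F : mod_sheaf O).
Variables (A : exterior_algebra F) (k : nat).

Inductive wedge_span (U : opens X) : A U -> Prop :=
| wedge_span0 : wedge_span 0
| wedge_spanD (s : A U) (a : O U) (w : seq (F U)) :
    wedge_span s -> size w = k ->
    wedge_span (s + ain A U a * \prod_(x <- w) ext_in A x).

(* The k-th exterior power sheaf, as the degree k part of the exterior algebra:
   sections that are locally sums of k-fold products of sections of F. *)
Definition in_ext_pow (U : opens X) (s : A U) : Prop :=
  forall x, (U : set X) x -> exists (V : opens X) (h : V `<=` U),
    (V : set X) x /\ wedge_span (ares A h s).

Lemma wedge_span_res (U V : opens X) (h : V `<=` U) (s : A U) :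
  wedge_span s -> wedge_span (ares A h s).
Proof.
have [_ _ jn] := ext_in_wedge A.
elim=> [|{}s a w _ IH sw]; first by rewrite rmorph0; constructor.
rewrite rmorphD rmorphM ain_res rmorph_prod.
under eq_bigr do rewrite jn.
rewrite -(big_map (fun x => mres F h x) xpredT (fun y => ext_in A y)).
by apply: wedge_spanD => //; rewrite size_map.
Qed.

Lemma wedge_span_add (U : opens X) (s t : A U) :
  wedge_span s -> wedge_span t -> wedge_span (s + t).
Proof.
move=> Hs; elim=> [|{}t a w _ IH sw]; first by rewrite addr0.
by rewrite addrA; apply: wedge_spanD.
Qed.

Lemma wedge_span_opp (U : opens X) (s : A U) : wedge_span s -> wedge_span (- s).
Proof.
elim=> [|{}s a w _ IH sw]; first by rewrite oppr0; constructor.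
by rewrite opprD -mulNr -rmorphN; apply: wedge_spanD.
Qed.

Lemma wedge_span_ext_pow (U : opens X) (s : A U) : wedge_span s -> in_ext_pow s.
Proof.
by move=> Hs x Ux; exists U, (@subset_refl _ U); split=> //; exact: wedge_span_res.
Qed.

Definition ext_pow_pred (U : opens X) : {pred A U} :=
  fun s => `[< in_ext_pow s >].

Lemma ext_pow_zmod_closed (U : opens X) : zmod_closed (@ext_pow_pred U).
Proof.
split=> [|s t]; first by apply/asboolP/wedge_span_ext_pow; constructor.
move=> /asboolP Hs /asboolP Ht; apply/asboolP => x Ux.
have [V [hV [Vx sV]]] := Hs x Ux; have [W [hW [Wx tW]]] := Ht x Ux.
have iV : opens_setI V W `<=` V by move=> y [].
have iW : opens_setI V W `<=` W by move=> y [].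
have h : opens_setI V W `<=` U by move=> y [/hV].
have [[_ ac] _] := asheaf A.
exists (opens_setI V W), h; split=> //; rewrite rmorphB.
apply: wedge_span_add; last apply: wedge_span_opp.
  by rewrite -(ac _ _ _ hV iV h); exact: wedge_span_res.
by rewrite -(ac _ _ _ hW iW h); exact: wedge_span_res.
Qed.

HB.instance Definition _ (U : opens X) :=
  GRing.isZmodClosed.Build (A U) (@ext_pow_pred U) (ext_pow_zmod_closed U).

Record ext_pow_sec (U : opens X) :=
  ExtPowSec { ext_val : A U; _ : ext_pow_pred ext_val }.

HB.instance Definition _ (U : opens X) := [isSub for @ext_val U].
HB.instance Definition _ (U : opens X) := [Choice of ext_pow_sec U by <:].
HB.instance Definition _ (U : opens X) :=
  [SubChoice_isSubZmodule of ext_pow_sec U by <:].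

Lemma in_ext_pow_res (U V : opens X) (h : V `<=` U) (s : ext_pow_sec U) :
  ext_pow_pred (ares A h (ext_val s)).
Proof.
case: s => s /= /asboolP Hs; apply/asboolP => x Vx.
have [W [hW [Wx sW]]] := Hs x (h x Vx).
have iV : opens_setI V W `<=` V by move=> y [].
have iW : opens_setI V W `<=` W by move=> y [].
have i : opens_setI V W `<=` U by move=> y [/h].
have [[_ ac] _] := asheaf A.
exists (opens_setI V W), iV; split=> //.
by rewrite (ac _ _ _ h iV i) -(ac _ _ _ hW iW i); exact: wedge_span_res.
Qed.

Definition ext_pow_res (U V : opens X) (h : V `<=` U) (s : ext_pow_sec U) :
  ext_pow_sec V := ExtPowSec (in_ext_pow_res h s).

Lemma ext_pow_res_additive (U V : opens X) (h : V `<=` U) :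
  zmod_morphism (ext_pow_res h).
Proof. by move=> s t; apply: val_inj; rewrite /= rmorphB. Qed.

HB.instance Definition _ (U V : opens X) (h : V `<=` U) :=
  GRing.isZmodMorphism.Build (ext_pow_sec U) (ext_pow_sec V) (ext_pow_res h)
    (ext_pow_res_additive h).

Lemma ext_pow_presheaf :
  is_presheaf (fun U V (h : V `<=` U) => ext_pow_res h).
Proof.
have [[ai ac] _] := asheaf A.
split=> [U h s|U V W hVU hWV hWU s]; apply: val_inj => /=; first exact: ai.
exact: ac.
Qed.

Definition ext_pow : ab_presheaf X :=
  @AbPresheaf X (fun U => ext_pow_sec U : zmodType)
    (fun U V h => ext_pow_res h : {additive _ -> _}) ext_pow_presheaf.

End ExteriorPower.

(* An isomorphism of E|_U with O_U^M. *)
Record trivialization (X : topologicalType) (O : ring_sheaf X)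
    (E : mod_sheaf O) (M : nat) (U : opens X) := Trivialization {
  triv : forall V : opens X, V `<=` U -> {linear E V -> 'cV[O V]_M};
  triv_inv : forall V : opens X, V `<=` U -> 'cV[O V]_M -> E V;
  trivK : forall (V : opens X) (h : V `<=` U), cancel (triv h) (triv_inv h);
  triv_invK : forall (V : opens X) (h : V `<=` U), cancel (triv_inv h) (triv h);
  triv_res : forall (V W : opens X) (hV : V `<=` U) (hW : W `<=` U)
    (h : W `<=` V) (s : E V),
    triv hW (mres E h s) = map_mx (rres O h) (triv hV s) }.

Definition locally_free (X : topologicalType) (O : ring_sheaf X) (M : nat)
    (E : mod_sheaf O) : Prop :=
  forall x : X, exists U : opens X,
    (U : set X) x /\ inhabited (trivialization E M U).

Record GLmx (R : comPzRingType) (M : nat) := MkGLmx {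
  gl_mx :> 'M[R]_M;
  gl_inv : 'M[R]_M;
  gl_mulmxV : gl_mx *m gl_inv = 1%:M;
  gl_mulVmx : gl_inv *m gl_mx = 1%:M }.

Definition mx_of (R : comPzRingType) (M : nat) (f : 'cV[R]_M -> 'cV[R]_M) :
  'M[R]_M := \matrix_(a, b) f (delta_mx b 0) a 0.

Record open_cover (X : topologicalType) := OpenCover {
  cov_disp : Order.disp_t;
  cov_idx : orderType cov_disp;
  cov_set :> cov_idx -> opens X;
  cov_cover : forall x : X, exists i, (cov_set i : set X) x }.

Section Transition.
Variables (X : topologicalType) (O : ring_sheaf X) (E : mod_sheaf O) (M : nat).
Variables (U : open_cover X) (phi : forall i, trivialization E M (U i)).

Definition subIl (i j : cov_idx U) : opens_setI (U i) (U j) `<=` U i :=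
  @subIsetl _ _ _.
Definition subIr (i j : cov_idx U) : opens_setI (U i) (U j) `<=` U j :=
  @subIsetr _ _ _.

Definition chg i j (v : 'cV[O (opens_setI (U i) (U j))]_M) :=
  triv (phi i) (@subIl i j) (triv_inv (phi j) (@subIr i j) v).
Definition chg_inv i j (v : 'cV[O (opens_setI (U i) (U j))]_M) :=
  triv (phi j) (@subIr i j) (triv_inv (phi i) (@subIl i j) v).

Lemma mx_ofE (R : comPzRingType) (f : 'cV[R]_M -> 'cV[R]_M) (v : 'cV[R]_M) :
  linear f -> mx_of f *m v = f v.
Proof.
move=> lf; pose g := HB.pack f (GRing.isLinear.Build R _ _ _ f lf) : {linear _ -> _}.
have fE u : f u = g u by [].
rewrite [in RHS](matrix_sum_delta v) fE linear_sum.
apply/colP => a; rewrite mxE summxE; apply: eq_bigr => b _.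
by rewrite big_ord1 linearZ mxE [in RHS]mxE mulrC fE.
Qed.

Lemma triv_inv_linear (V W : opens X) (p : trivialization E M W) (h : V `<=` W) :
  linear (triv_inv p h).
Proof.
move=> a u v; apply: (can_inj (trivK p h)).
by rewrite linearP !triv_invK.
Qed.

Lemma mx_of_mul (R : comPzRingType) (f f' : 'cV[R]_M -> 'cV[R]_M) :
  linear f -> linear f' -> cancel f' f -> mx_of f *m mx_of f' = 1%:M.
Proof.
move=> lf lf' K; apply/matrixP => a b.
have -> : (mx_of f *m mx_of f') a b = (mx_of f *m (mx_of f' *m delta_mx b 0)) a (0 : 'I_1).
  by rewrite mulmxA -colE [RHS]mxE.
by rewrite !mx_ofE // K !mxE eqxx andbT.
Qed.

Lemma chg_linear i j : linear (@chg i j).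
Proof. by move=> a u v; rewrite /chg triv_inv_linear linearP. Qed.
Lemma chg_inv_linear i j : linear (@chg_inv i j).
Proof. by move=> a u v; rewrite /chg_inv triv_inv_linear linearP. Qed.
Lemma chgK i j : cancel (@chg i j) (@chg_inv i j).
Proof. by move=> v; rewrite /chg /chg_inv trivK triv_invK. Qed.
Lemma chg_invK i j : cancel (@chg_inv i j) (@chg i j).
Proof. by move=> v; rewrite /chg /chg_inv trivK triv_invK. Qed.

(* g_ij = phi_i o phi_j^-1 *)
Definition transition (i j : cov_idx U) : GLmx (O (opens_setI (U i) (U j))) M :=
  MkGLmx (mx_of_mul (@chg_linear i j) (@chg_inv_linear i j) (@chg_invK i j))
       (mx_of_mul (@chg_inv_linear i j) (@chg_linear i j) (@chgK i j)).

End Transition.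

(* Only used for equivalence relations R; a class is the predicate R a. *)
Definition eq_classes (T : Type) (R : T -> T -> Prop) : Type :=
  {A : T -> Prop | exists a, A = R a}.
Definition eq_class (T : Type) (R : T -> T -> Prop) (a : T) : eq_classes R :=
  exist _ (R a) (ex_intro _ a erefl).

Definition is_incr (X : topologicalType) (U : open_cover X) (p : nat)
    (i : 'I_p.+1 -> cov_idx U) : Prop :=
  forall a b : 'I_p.+1, (a < b)%N -> (i a < i b)%O.

Record incr (X : topologicalType) (U : open_cover X) (p : nat) := Incr {
  incr_fun :> 'I_p.+1 -> cov_idx U;
  incrP : is_incr incr_fun }.

Section Cech.
Variables (X : topologicalType) (F : ab_presheaf X).

Definition inter (U : open_cover X) (p : nat) (i : 'I_p.+1 -> cov_idx U) : opens X :=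
  opens_bigcap (fun l => U (i l)).

Definition cochain (U : open_cover X) (p : nat) : Type :=
  forall i : incr U p, F (inter i).

Lemma incr_del_subproof (U : open_cover X) (p : nat) (i : incr U p.+1)
  (j : 'I_p.+2) : is_incr (fun l : 'I_p.+1 => i (lift j l)).
Proof.
move=> a b ab; apply: incrP => /=.
by rewrite /bump ltnNge; apply/negP; rewrite leq_bump2 leqNgt ab.
Qed.

Definition incr_del (U : open_cover X) (p : nat) (i : incr U p.+1) (j : 'I_p.+2) :
  incr U p := Incr (@incr_del_subproof U p i j).

Lemma inter_comp (U : open_cover X) (p q : nat) (i : 'I_p.+1 -> cov_idx U)
  (f : 'I_q.+1 -> 'I_p.+1) : inter i `<=` inter (fun l => i (f l)).
Proof. by move=> x Hx l _; exact: Hx. Qed.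

Definition cech_d (U : open_cover X) (p : nat) (s : cochain U p) : cochain U p.+1 :=
  fun i => \sum_(j < p.+2)
    abres F (@inter_comp U p.+1 p i (lift j)) (s (incr_del i j)) *~ ((-1) ^+ j).

Definition is_cocycle (U : open_cover X) (p : nat) (s : cochain U p) : Prop :=
  forall i, cech_d s i = 0.

Definition is_coboundary (U : open_cover X) (p : nat) : cochain U p -> Prop :=
  match p with
  | 0 => fun s => forall i, s i = 0
  | q.+1 => fun s => exists b : cochain U q, forall i, s i = cech_d b i
  end.

Definition cocycle (U : open_cover X) (p : nat) : Type :=
  {s : cochain U p | is_cocycle s}.

Definition cohomologous (U : open_cover X) (p : nat) (s t : cocycle U p) : Prop :=
  is_coboundary (fun i => sval s i - sval t i).

Definition cechH (U : open_cover X) (p : nat) : Type :=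
  eq_classes (@cohomologous U p).

Definition cech_class (U : open_cover X) (p : nat) (s : cochain U p)
    (hs : is_cocycle s) : cechH U p :=
  eq_class (@cohomologous U p) (exist _ s hs).

Record refinement (W U : open_cover X) := Refinement {
  ref_map :> cov_idx W -> cov_idx U;
  ref_sub : forall j, W j `<=` U (ref_map j) }.

Lemma inter_perm (U : open_cover X) (p : nat) (i : 'I_p.+1 -> cov_idx U)
  (s : 'S_p.+1) : inter i `<=` inter (fun l => i (s l)).
Proof. exact: inter_comp. Qed.

(* Cochains live on increasing tuples only.  The alternating extension of a
   cochain to arbitrary index tuples: sgn(s) times the value at the increasing
   rearrangement i o s, and 0 if i has repeated entries (the sum has at most
   one nonzero term). *)
Definition alt_ext (U : open_cover X) (p : nat) (c : cochain U p)
    (i : 'I_p.+1 -> cov_idx U) : F (inter i) :=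
  \sum_(s : 'S_p.+1)
    match pselect (is_incr (fun l => i (s l))) with
    | left h => abres F (@inter_perm U p i s) (c (Incr h)) *~ ((-1) ^+ s)
    | right _ => 0
    end.

Lemma inter_ref (W U : open_cover X) (tau : refinement W U) (p : nat)
  (i : 'I_p.+1 -> cov_idx W) : inter i `<=` inter (fun l => tau (i l)).
Proof. by move=> x Hx l _; apply: ref_sub; exact: Hx. Qed.

(* A refinement map need not be monotone, whence the alternating extension. *)
Definition pullback (W U : open_cover X) (tau : refinement W U) (p : nat)
    (c : cochain U p) : cochain W p :=
  fun i => abres F (@inter_ref W U tau p i) (alt_ext c (fun l => tau (i l))).

(* b is the image of a under the map of cohomology induced by a refinement map,
   a class [c] being sent to the class of the pullback of c. *)
Definition refines_to (p : nat) (a b : {U : open_cover X & cechH U p}) : Prop :=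
  exists (tau : refinement (projT1 b) (projT1 a))
    (c : cocycle (projT1 a) p) (c' : cocycle (projT1 b) p),
    [/\ projT2 a = eq_class (@cohomologous _ p) c,
        projT2 b = eq_class (@cohomologous _ p) c' &
        forall i, sval c' i = pullback tau (sval c) i].

(* The direct limit of the H^p(U), as the quotient of their disjoint union. *)
Definition cechH_lim (p : nat) : Type :=
  eq_classes (clos_refl_sym_trans _ (@refines_to p)).

Definition cech_to_lim (U : open_cover X) (p : nat) (a : cechH U p) : cechH_lim p :=
  eq_class _ (existT _ U a).

End Cech.

Section TInvariant.
Variables (K : fieldType) (X : scheme_over K).
Variables (Om : kaehler X) (La : exterior_algebra Om) (k : nat).
Variables (M : nat) (E : mod_sheaf (sch_O X)).
Variables (U : open_cover X) (phi : forall i, trivialization E M (U i)).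

Local Notation O := (sch_O X).

(* g_ij^-1 dg_ij on an open subset W of the intersection of U_i and U_j *)
Definition dlog (i j : cov_idx U) (W : opens X)
    (h : W `<=` opens_setI (U i) (U j)) : 'M[La W]_M :=
  map_mx (fun a => ain La W (rres O h a)) (gl_inv (transition phi i j)) *m
  map_mx (fun a => ext_in La (dK Om (rres O h a))) (transition phi i j).

Lemma inter_pair (p : nat) (i : 'I_p.+1 -> cov_idx U) (a b : 'I_p.+1) :
  inter i `<=` opens_setI (U (i a)) (U (i b)).
Proof. by move=> x Hx; split; exact: Hx. Qed.

Definition tform_val (i : 'I_k.+1 -> cov_idx U) : La (inter i) :=
  \sum_(s : 'S_k.+1)
    ain La _ (const_sec (inter i) ((-1) ^+ s / (k.+1)`!%:R)) *
    \tr (\prod_(l < k)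
           dlog (@inter_pair k i (s (widen_ord (leqnSn k) l)) (s ord_max))).

Lemma wedge_span_scale (p : nat) (W : opens X) (a : O W) (s : La W) :
  wedge_span p s -> wedge_span p (ain La W a * s).
Proof.
elim=> [|{}s b w _ IH sw]; first by rewrite mulr0; constructor.
by rewrite mulrDr mulrA -rmorphM; apply: wedge_spanD.
Qed.

Lemma wedge_span_mulr (p : nat) (W : opens X) (s : La W) (x : Om W) :
  wedge_span p s -> wedge_span p.+1 (s * ext_in La x).
Proof.
elim=> [|{}s b w _ IH sw]; first by rewrite mul0r; constructor.
rewrite mulrDl -mulrA.
have -> : (\prod_(y <- w) ext_in La y) * ext_in La x =
          \prod_(y <- rcons w x) ext_in La y by rewrite big_rcons.
by apply: wedge_spanD; rewrite ?size_rcons ?sw.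
Qed.

Lemma wedge_span_sum (p : nat) (W : opens X) (J : finType) (f : J -> La W) :
  (forall j, wedge_span p (f j)) -> wedge_span p (\sum_j f j).
Proof.
by move=> H; apply: big_ind => //; [constructor | exact: wedge_span_add].
Qed.

Lemma wedge_span_prod (p : nat) (W : opens X) (A : 'I_p -> 'M[La W]_M) :
  (forall l, exists B C : 'M[O W]_M, A l = map_mx (ain La W) B *m
     map_mx (fun a => ext_in La (dK Om a)) C) ->
  forall a b, wedge_span p ((\prod_(l < p) A l) a b).
Proof.
elim: p A => [|p IH] A HA a b.
  rewrite big_ord0 mxE; have -> : (1 *+ (a == b) : La W) =
      0 + ain La W (1 *+ (a == b)) * \prod_(x <- [::]) ext_in La x.
    by rewrite big_nil mulr1 add0r rmorphMn rmorph1.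
  by apply: wedge_spanD => //; constructor.
rewrite big_ord_recr mxE; apply: wedge_span_sum => c.
have [B [C ->]] := HA ord_max.
rewrite mxE mulr_sumr; apply: wedge_span_sum => e.
rewrite !mxE mulrA -ain_central; apply: wedge_span_mulr.
by apply: wedge_span_scale; apply: IH => l; exact: HA.
Qed.

Lemma tform_subproof (i : 'I_k.+1 -> cov_idx U) :
  ext_pow_pred k (tform_val i).
Proof.
apply/asboolP/wedge_span_ext_pow/wedge_span_sum => s.
apply: wedge_span_scale; apply: wedge_span_sum => a.
apply: wedge_span_prod => l.
exists (map_mx (rres O (@inter_pair k i (s (widen_ord (leqnSn k) l)) (s ord_max)))
          (gl_inv (transition phi _ _))),
       (map_mx (rres O (@inter_pair k i (s (widen_ord (leqnSn k) l)) (s ord_max)))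
          (transition phi _ _)).
by rewrite /dlog -!map_mx_comp.
Qed.

Definition tform (i : 'I_k.+1 -> cov_idx U) : ext_pow La k (inter i) :=
  ExtPowSec (tform_subproof i).

Definition fhat : cochain (ext_pow La k) U k := fun i => tform i.

End TInvariant.

Arguments fhat {K X Om} La k {M E U} phi.

(* Main.v *)
Require Import Defs.
From HB Require Import structures.
From mathcomp Require Import all_boot all_order all_algebra all_fingroup.
From mathcomp Require Import all_classical topology.
From Stdlib Require Import Relation_Operators.

Set Implicit Arguments.
Unset Strict Implicit.
Unset Printing Implicit Defensive.
Import Order.TTheory GRing.Theory.
Local Open Scope classical_set_scope.
Local Open Scope ring_scope.

(** A trivialization [p] of [E] over an open set [W] is a frame, and carries the
    flat connection for which that frame is constant.  Seen from another frame
    [q], this connection has the matrix of 1-forms [w_p = h^-1 dh], where [h] is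
    the transition matrix from [q] to [p].  The transition functions satisfy
    [g_pr^-1 dg_pr = H (w_p - w_r) H^-1] with [H] the transition matrix from
    [q] to [r] ([connection_change]).  The matrix [H] has entries in the centre,
    so it disappears from the traces, and on every open set where a frame [q]
    exists
      [t = 1/(k+1)! sum_s sgn(s) tr prod_l (w_(s l) - w_(s (k+1)))].

    Everything then follows from one remark: the alternating sum over the
    permutations of the indices kills each monomial in which two of the indices
    do not occur, since transposing these two changes the sign only
    ([alt_tperm_inv]).

    - Expanding the product leaves the monomials of degree at most one in
      [w_(s (k+1))], and these agree up to a transposition, so that
      [t = (k+1)/(k+1)! sum_s sgn(s) tr prod_l w_(s l)] ([alt_prod_diff]).
    - The Cech differential turns an alternating sum over [k+1] indices into one
      over [k+2] indices of the same monomials ([alt_faces]).  The monomials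
      of [t] have degree [k], hence miss two of [k+2] indices: [t] is a cocycle.
    - For a second family of frames, with matrices [v], the product of the [w]
      minus that of the [v] telescopes into the sum over [j] of
      [prod_(l<j) v_l (w_j - v_j) prod_(l>j) w_l].  Subtracting [v_j] from every
      other factor does not change the alternating sum over [k+1] indices
      ([alt_prod_homotopy]), and makes the expression a function of transition
      matrices alone, independent of [q].  This is a cochain of degree [k-1],
      and its coboundary is the difference of the two cocycles.

    For two covers, the frames are restricted to the cover by the intersections
    of [U_i] with [V_j].  The cochain [t] is alternating and commutes with
    restriction, so its pullback along a refinement map is the cochain of the
    restricted frames ([pullback_fhat]); on the common refinement the two
    families of frames are compared as above. *)

(** * Alternating sums over permutations *)

Section Alternation.
Variable V : zmodType.

Definition alt n (f : 'S_n -> V) : V := \sum_s f s *~ (-1) ^+ s.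

Lemma alt_sum n (J : Type) (r : seq J) (P : pred J) (f : J -> 'S_n -> V) :
  alt (fun s => \sum_(j <- r | P j) f j s) = \sum_(j <- r | P j) alt (f j).
Proof.
rewrite /alt exchange_big /=; apply: eq_bigr => s _.
by rewrite mulrz_suml.
Qed.

Lemma eq_alt n (f g : 'S_n -> V) : f =1 g -> alt f = alt g.
Proof. by move=> fg; apply: eq_bigr => s _; rewrite fg. Qed.

Lemma alt_sub n (f g : 'S_n -> V) : alt (fun s => f s - g s) = alt f - alt g.
Proof. by rewrite /alt -sumrB; apply: eq_bigr => s _; rewrite mulrzBl. Qed.

Lemma alt_opp n (f : 'S_n -> V) : alt (fun s => - f s) = - alt f.
Proof. by rewrite /alt -sumrN; apply: eq_bigr => s _; rewrite mulNrz. Qed.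

Lemma alt_tperm n (a b : 'I_n) (f : 'S_n -> V) : a != b ->
  alt (fun s => f (tperm a b * s)%g) = - alt f.
Proof.
move=> ab; rewrite /alt [in RHS](reindex_inj (mulgI (tperm a b))) /= -sumrN.
apply: eq_bigr => s _; rewrite -mulrNz odd_permM odd_tperm ab /=.
by rewrite signrN opprK.
Qed.

(** Multiplication by the transposition exchanges even and odd permutations.
    The two halves of the sum cancel, which, unlike the relation [x = - x],
    gives 0 also when 2 is not invertible. *)
Lemma alt_tperm_inv n (a b : 'I_n) (f : 'S_n -> V) : a != b ->
  (forall s, f (tperm a b * s)%g = f s) -> alt f = 0.
Proof.
move=> ab fE; rewrite /alt (bigID (fun s : 'S_n => odd_perm s)) /=.
rewrite (reindex_inj (mulgI (tperm a b))) /=.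
apply/eqP; rewrite addr_eq0 -sumrN; apply/eqP.
apply: eq_big => s; rewrite odd_permM odd_tperm ab //= => /negPf so.
by rewrite fE so /= expr1 mulrN1z.
Qed.

(** A permutation [t] of [n+1] indices amounts to the value [m] of [t] at the
    last index and a permutation of the [n] others; the signs of both differ by
    [(-1)^(n+m)].  This is what relates the Cech differential to [alt]. *)
Lemma alt_faces n (f : ('I_n -> 'I_n.+1) -> V) :
  \sum_(m < n.+1) alt (fun s : 'S_n => f (fun l => lift m (s l))) *~ (-1) ^+ m =
  alt (fun t : 'S_n.+1 => f (fun l => t (lift ord_max l))) *~ (-1) ^+ n.
Proof.
pose h (p : 'I_n.+1 * 'S_n) := lift_perm ord_max p.1 p.2.
have h_inj : injective h.
  move=> [m s] [m' s'] /= /permP e.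
  have em : m = m' by have := e ord_max; rewrite /h !lift_perm_id.
  congr (_, _) => //; apply/permP => l.
  by have := e (lift ord_max l); rewrite /h !lift_perm_lift em /= => /lift_inj.
have h_bij : bijective h.
  by apply: inj_card_bij h_inj _; rewrite card_prod !card_Sn card_ord factS.
rewrite /alt (reindex h) /=; last exact: onW_bij.
under eq_bigr do rewrite mulrz_suml.
rewrite pair_big_dep /= mulrz_suml; apply: eq_bigr => -[m s] _ /=.
rewrite /h /= odd_lift_perm -!mulrzA.
congr (f _ *~ _); first by apply: funext => l; rewrite lift_perm_lift.
rewrite !signr_addb !(signr_odd _ (nat_of_ord _)) /= [RHS]mulrC !mulrA.
by rewrite -expr2 sqrr_sign mul1r -[RHS]mulrA; exact: mulrC.
Qed.
End Alternation.

(** * Alternating sums of noncommutative products *)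

Section Products.
Variable R : pzRingType.

Lemma telescope_prod k (u v : 'I_k -> R) :
  \prod_(l < k) u l - \prod_(l < k) v l =
  \sum_(j < k) \prod_(l < k)
    (if (l < j)%N then v l else if l == j then u l - v l else u l).
Proof.
elim: k u v => [|k IH] u v; first by rewrite !big_ord0 subrr.
rewrite !big_ord_recr /=.
have -> : \prod_(i < k) u (widen_ord (leqnSn k) i) * u ord_max -
    \prod_(i < k) v (widen_ord (leqnSn k) i) * v ord_max =
    (\prod_(i < k) u (widen_ord (leqnSn k) i) -
      \prod_(i < k) v (widen_ord (leqnSn k) i)) * u ord_max +
    \prod_(i < k) v (widen_ord (leqnSn k) i) * (u ord_max - v ord_max).
  by rewrite mulrBl mulrBr addrA subrK.
rewrite IH mulr_suml; congr (_ + _).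
  apply: eq_bigr => j _; rewrite big_ord_recr /=.
  by rewrite ltnNge ltnW //= -val_eqE /= gtn_eqF.
rewrite ltnn eqxx; congr (_ * _).
by apply: eq_bigr => l _ /=; rewrite ltn_ord.
Qed.

Lemma prod_opp_at (I : eqType) (r : seq I) (i0 : I) (F : I -> R) :
  \prod_(i <- r) (if i == i0 then - F i else F i) =
  (-1) ^+ count_mem i0 r * \prod_(i <- r) F i.
Proof.
elim: r => [|i r IH]; first by rewrite !big_nil mulr1.
rewrite !big_cons IH /= exprD; case: eqP => _; rewrite ?mul1r ?expr1.
  by rewrite !mulNr mul1r !mulrA commr_sign.
by rewrite !mulrA commr_sign.
Qed.

Lemma prod_eq0_at (I : eqType) (r : seq I) (i : I) (F : I -> R) :
  i \in r -> F i = 0 -> \prod_(j <- r) F j = 0.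
Proof.
elim: r => // j r IH; rewrite inE big_cons => /predU1P[<- -> | ir Fi].
  by rewrite mul0r.
by rewrite IH ?mulr0.
Qed.

Variables (k : nat).
Implicit Types x y : 'I_k.+1 -> R.

Local Notation up l := (lift ord_max l).

Lemma up_neq_max (l : 'I_k) : up l != ord_max.
Proof. by rewrite eq_sym neq_lift. Qed.

Lemma tperm_up (l l0 : 'I_k) (b : 'I_k.+1) : l != l0 -> up l != b ->
  tperm (up l0) b (up l) = up l.
Proof.
by move=> ll0 lb; rewrite tpermD // 1?eq_sym // (inj_eq lift_inj) // eq_sym.
Qed.

Lemma alt_prod_miss (a b : 'I_k.+1) (u : 'S_k.+1 -> 'I_k -> R) : a != b ->
  (forall s l, u (tperm a b * s)%g l = u s l) ->
  alt (fun s => \prod_(l < k) u s l) = 0.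
Proof.
by move=> ab uE; apply: (alt_tperm_inv ab) => s; apply: eq_bigr => l _.
Qed.

(** Expand the product: [m D] is the monomial where [- x (s ord_max)] is chosen
    at the positions in [D].  If [D] is empty this is the monomial on the right.
    If [D = [set l0]], it becomes that monomial after transposing [up l0] and
    [ord_max], the two signs compensating.  If [D] contains [l0 != l1], the
    indices [up l0] and [up l1] do not occur.  There are [1 + k] sets [D] of
    cardinal at most 1. *)
Lemma alt_prod_diff x :
  alt (fun s => \prod_(l < k) (x (s (up l)) - x (s ord_max))) =
  alt (fun s => \prod_(l < k) x (s (up l))) *+ k.+1.
Proof.
pose m (D : {set 'I_k}) (s : 'S_k.+1) :=
  \prod_(l < k) (if l \in D then - x (s ord_max) else x (s (up l))).
pose P := alt (fun s => \prod_(l < k) x (s (up l))).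
have m0 (D : {set 'I_k}) : #|D| == 0%N -> alt (m D) = P.
  rewrite cards_eq0 => /eqP ->; apply: eq_alt => s; apply: eq_bigr => l _.
  by rewrite inE.
have m1 (D : {set 'I_k}) : #|D| == 1%N -> alt (m D) = P.
  case/cards1P => l0 ->; rewrite -[P]opprK -(alt_tperm _ (up_neq_max l0)).
  rewrite -alt_opp; apply: eq_alt => s; rewrite /m.
  rewrite -[RHS]mulN1r -[X in _ = X * _]expr1.
  have <- : count_mem l0 (index_enum 'I_k) = 1%N.
    by rewrite count_uniq_mem ?index_enum_uniq ?mem_index_enum.
  rewrite -prod_opp_at; apply: eq_bigr => l _; rewrite inE.
  case: eqVneq => [->|ll0]; rewrite permM ?tpermL //.
  by rewrite tperm_up ?up_neq_max.
have m2 (D : {set 'I_k}) : (1 < #|D|)%N -> alt (m D) = 0.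
  case/card_gt1P => l0 [l1 [l0D l1D l01]].
  have l01' : up l0 != up l1 by rewrite (inj_eq lift_inj).
  apply: (alt_prod_miss l01') => s l; rewrite !permM tpermD ?up_neq_max //.
  case: ifPn => // lD; rewrite tperm_up //.
    by apply: contraNneq lD => ->.
  by rewrite (inj_eq lift_inj); apply: contraNneq lD => ->.
transitivity (alt (fun s => \sum_D m D s)).
  apply: eq_alt => s; rewrite -bigA_distr.
  by apply: eq_bigr => l _; rewrite addrC.
rewrite alt_sum (bigID (fun D : {set 'I_k} => #|D| == 0%N)) /=.
rewrite (eq_bigr _ m0) sumr_const -cardsE card_draws card_ord bin0 [RHS]mulrS.
congr (_ + _).
rewrite (bigID (fun D : {set 'I_k} => #|D| == 1%N)) /= [X in _ + X]big1; last first.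
  by move=> D /andP[D0 D1]; apply: m2; case: #|D| D0 D1 => [|[]].
rewrite addr0 (eq_bigl (fun D : {set 'I_k} => #|D| == 1%N)); last first.
  by move=> D; case: eqP => [->|].
by rewrite (eq_bigr _ m1) sumr_const -cardsE card_draws card_ord bin1.
Qed.

(** Once the right-hand side is telescoped, the [j]-th summands differ by the
    terms [- y (s (up j))] in the factors other than the [j]-th.  Telescoping
    this difference in turn, the term that picks [- y (s (up j))] at the
    position [i] involves neither [up i] nor [ord_max]. *)
Lemma alt_prod_homotopy x y :
  alt (fun s => \sum_(j < k) \prod_(l < k)
    ((if (l < j)%N then y (s (up l)) else x (s (up l))) - y (s (up j)))) =
  alt (fun s => \prod_(l < k) x (s (up l))) -
  alt (fun s => \prod_(l < k) y (s (up l))).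
Proof.
rewrite -alt_sub.
under [RHS]eq_alt do rewrite telescope_prod.
rewrite !alt_sum; apply: eq_bigr => j _; apply/eqP.
rewrite -subr_eq0 -alt_sub; apply/eqP.
under eq_alt do rewrite telescope_prod.
rewrite alt_sum big1 // => i _; have [-> | ij] := eqVneq i j.
  (* the j-th factors agree, so their difference is 0 *)
  rewrite /alt big1 // => s _.
  rewrite (prod_eq0_at (i := j)) ?mul0rz ?mem_index_enum //.
  by rewrite ltnn eqxx subrr.
apply: (alt_prod_miss (up_neq_max i)) => s l; rewrite !permM.
have ji : j != i by rewrite eq_sym.
rewrite (tperm_up ji (up_neq_max j)).
have [->|li] := eqVneq l i; last by rewrite tperm_up ?up_neq_max.
rewrite ltnn (negPf ij).
by case: ifP => _; rewrite [X in X = _]addrAC [RHS]addrAC !subrr.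
Qed.
End Products.

(** * Frames and transition matrices *)

Section Frames.
Variables (X : topologicalType) (O : ring_sheaf X) (E : mod_sheaf O) (M : nat).

(** The inclusions are composed by explicit functions, so that restricting in
    two steps is convertible to restricting in one, up to the inclusion proof. *)
Definition restrict_triv (U W : opens X) (h : W `<=` U)
    (p : trivialization E M U) : trivialization E M W :=
  Trivialization
    (fun V (i : V `<=` W) => trivK p (fun x Vx => h x (i x Vx)))
    (fun V (i : V `<=` W) => triv_invK p (fun x Vx => h x (i x Vx)))
    (fun V V' (i : V `<=` W) (i' : V' `<=` W) j =>
       @triv_res _ _ _ _ _ p V V' (fun x Vx => h x (i x Vx))
         (fun x Vx => h x (i' x Vx)) j).

Lemma restrict_triv_comp (U V W : opens X) (h : V `<=` U) (h' : W `<=` V)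
    (h'' : W `<=` U) (p : trivialization E M U) :
  restrict_triv h' (restrict_triv h p) = restrict_triv h'' p.
Proof.
by rewrite (Prop_irrelevance h'' (fun x Wx => h x (h' x Wx))).
Qed.

Definition frame_change (W : opens X) (p q : trivialization E M W) :
    'M[O W]_M :=
  mx_of (fun v => triv p (fun x (Wx : (W : set X) x) => Wx)
                    (triv_inv q (fun x (Wx : (W : set X) x) => Wx) v)).

Lemma change_linear (U U' W : opens X) (p : trivialization E M U)
    (q : trivialization E M U') (h : W `<=` U) (h' : W `<=` U') :
  linear (fun v => triv p h (triv_inv q h' v)).
Proof. by move=> a u v; rewrite triv_inv_linear linearP. Qed.

Lemma change_res (U U' V W : opens X) (p : trivialization E M U)
    (q : trivialization E M U') (hU : V `<=` U) (hU' : V `<=` U')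
    (hW : W `<=` U) (hW' : W `<=` U') (i : W `<=` V) :
  map_mx (rres O i) (mx_of (fun v => triv p hU (triv_inv q hU' v))) =
  mx_of (fun v => triv p hW (triv_inv q hW' v)).
Proof.
apply/matrixP => a b; rewrite !mxE.
have -> : triv_inv q hW' (delta_mx b 0) = mres E i (triv_inv q hU' (delta_mx b 0)).
  apply: (can_inj (trivK q hW')).
  by rewrite (triv_res _ hU') !triv_invK map_delta_mx.
by rewrite (triv_res _ hU) mxE.
Qed.

Lemma frame_change_res (V W : opens X) (i : W `<=` V)
    (p q : trivialization E M V) :
  map_mx (rres O i) (frame_change p q) =
  frame_change (restrict_triv i p) (restrict_triv i q).
Proof. exact: change_res. Qed.

Lemma frame_changeM (W : opens X) (p q r : trivialization E M W) :
  frame_change p q *m frame_change q r = frame_change p r.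
Proof.
apply/matrixP => a b.
have -> : (frame_change p q *m frame_change q r) a b =
    (frame_change p q *m (frame_change q r *m delta_mx b 0)) a (0 : 'I_1).
  by rewrite mulmxA -colE [RHS]mxE.
rewrite !mx_ofE; try exact: change_linear.
by rewrite trivK mxE.
Qed.

Lemma frame_change_id (W : opens X) (p : trivialization E M W) :
  frame_change p p = 1%:M.
Proof. by apply/matrixP => a b; rewrite mxE triv_invK !mxE eqxx andbT. Qed.

End Frames.

(** * Connection matrices *)

Lemma prod_conj (R : pzRingType) (g g' : R) (I : Type) (r : seq I) (F : I -> R) :
  g' * g = 1 -> g * g' = 1 ->
  \prod_(i <- r) (g * F i * g') = g * (\prod_(i <- r) F i) * g'.
Proof.
move=> gK gK'; elim: r => [|i r IH]; first by rewrite !big_nil mulr1.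
by rewrite !big_cons IH !mulrA -(mulrA _ g') gK mulr1.
Qed.

Section Connection.
Variables (K : fieldType) (X : scheme_over K).
Variables (Om : kaehler X) (La : exterior_algebra Om).
Variables (M : nat) (E : mod_sheaf (sch_O X)).
Local Notation O := (sch_O X).

Section OneOpen.
Variable W : opens X.
Implicit Types (p q r : trivialization E M W).

Local Notation inc := (map_mx (ain La W)).
Definition ediff (a : O W) : La W := ext_in La (dK Om a).
Local Notation dmx := (map_mx ediff).

Lemma ediffD : {morph ediff : a b / a + b}.
Proof.
move=> a b; have [dD _ _ _] := dK_derivation Om.
have [jD _ _] := ext_in_wedge La.
by rewrite /ediff dD -[dK Om a]scale1r jD rmorph1 mul1r scale1r.
Qed.

Lemma ediffM (a b : O W) :
  ediff (a * b) = ain La W a * ediff b + ediff a * ain La W b.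
Proof.
have [_ dM _ _] := dK_derivation Om; have [jD _ _] := ext_in_wedge La.
have j0 : ext_in La (0 : Om W) = 0.
  have := jD W 1 0 0; rewrite scaler0 addr0 rmorph1 mul1r => /eqP.
  by rewrite -subr_eq subrr => /eqP.
rewrite /ediff dM jD -[b *: _]addr0 jD j0 addr0; congr (_ + _).
exact: ain_central.
Qed.

Lemma ediff0 : ediff 0 = 0.
Proof. by apply: (addrI (ediff 0)); rewrite -ediffD !addr0. Qed.

Lemma ediff1 : ediff 1 = 0.
Proof.
apply: (addrI (ediff 1)); rewrite addr0 -[in RHS](mulr1 1) ediffM.
by rewrite rmorph1 mul1r mulr1.
Qed.

Lemma ediff_sum (I : finType) (F : I -> O W) :
  ediff (\sum_i F i) = \sum_i ediff (F i).
Proof. exact: (big_morph ediff ediffD ediff0). Qed.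

Lemma ediff_mulmx (A B : 'M[O W]_M) :
  dmx (A *m B) = inc A *m dmx B + dmx A *m inc B.
Proof.
apply/matrixP => a b; rewrite !mxE ediff_sum -big_split.
by apply: eq_bigr => c _; rewrite !mxE ediffM.
Qed.

Lemma ediff_scalar1 : dmx (1%:M : 'M[O W]_M) = 0.
Proof.
by apply/matrixP => a b; rewrite !mxE; case: eqP => _; rewrite ?ediff1 ?ediff0.
Qed.

Definition connection p q : 'M[La W]_M :=
  inc (frame_change q p) *m dmx (frame_change p q).

(** Leibniz rule for the product of the transition matrices from [r] to [q] and
    from [q] to [p]; the matrix [H] from [q] to [r] satisfies
    [H d(H^-1) = - dH H^-1].  The difference of two connections is a tensor, so
    that a change of the reference [q] only conjugates it. *)
Lemma connection_change p q r :
  connection p r =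
  inc (frame_change r q) *m (connection p q - connection r q) *m
    inc (frame_change q r).
Proof.
have dI : inc (frame_change r q) *m dmx (frame_change q r) =
          - (dmx (frame_change r q) *m inc (frame_change q r)).
  apply/eqP; rewrite -addr_eq0 -ediff_mulmx frame_changeM frame_change_id.
  by rewrite ediff_scalar1.
rewrite /connection -(frame_changeM p q r) ediff_mulmx mulmxDr.
rewrite !mulmxA -!map_mxM frame_changeM dI.
rewrite mulmxBr mulmxBl !mulmxA -!map_mxM !frame_changeM frame_change_id.
by rewrite map_mx1 mul1mx addrC.
Qed.

(** The exterior algebra is not commutative, and the usual cyclicity of the
    trace fails in it; here the entries of one factor are central. *)
Lemma mxtrace_mul_central (A : 'M[O W]_M) (B : 'M[La W]_M) :
  \tr (inc A *m B) = \tr (B *m inc A).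
Proof.
rewrite /mxtrace; under eq_bigr do rewrite mxE.
under [RHS]eq_bigr do rewrite mxE.
rewrite exchange_big; apply: eq_bigr => a _; apply: eq_bigr => b _.
by rewrite !mxE ain_central.
Qed.

Variable k : nat.

Definition conn_trace r (p : 'I_k -> trivialization E M W) : La W :=
  \tr (\prod_(l < k) connection (p l) r).

Lemma conn_trace_change q r (p : 'I_k -> trivialization E M W) :
  conn_trace r p =
  \tr (\prod_(l < k) (connection (p l) q - connection r q)).
Proof.
rewrite /conn_trace.
have gK (q' r' : trivialization E M W) :
    inc (frame_change q' r') * inc (frame_change r' q') = 1.
  by rewrite -mulmxE -map_mxM frame_changeM frame_change_id map_mx1.
rewrite (eq_bigr _ (fun l _ => connection_change (p l) q r)) prod_conj //.
by rewrite -mulmxE -mulmxA mxtrace_mul_central -mulmxA mulmxE gK mulr1.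
Qed.
End OneOpen.
End Connection.

Lemma raddf_alt (V V' : zmodType) (h : {additive V -> V'}) n (f : 'S_n -> V) :
  h (alt f) = alt (fun s => h (f s)).
Proof. by rewrite /alt raddf_sum; apply: eq_bigr => s _; rewrite raddfMz. Qed.

(** * The form attached to a family of frames *)

Section Forms.
Variables (K : fieldType) (X : scheme_over K).
Variables (Om : kaehler X) (La : exterior_algebra Om).
Variables (M : nat) (E : mod_sheaf (sch_O X)).
Local Notation O := (sch_O X).
Local Notation frame W := (trivialization E M W).
Local Notation conn := (@connection K X Om La M E _).
Local Notation ctrace := (@conn_trace K X Om La M E _ _).

Section Restriction.
Variables (V W : opens X) (i : W `<=` V).

Lemma const_sec_res (c : K) : rres O i (const_sec V c) = const_sec W c.
Proof.
have [[_ rc] _] := rsheaf O.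
by rewrite /const_sec; exact: rc.
Qed.

Lemma ediff_res (a : O V) : ares La i (ediff La a) = ediff La (rres O i a).
Proof.
have [_ _ _ dr] := dK_derivation Om; have [_ _ jr] := ext_in_wedge La.
by rewrite /ediff jr dr.
Qed.

Lemma connection_res (p q : frame V) :
  map_mx (ares La i) (conn p q) =
  conn (restrict_triv i p) (restrict_triv i q).
Proof.
rewrite /connection map_mxM.
rewrite -!frame_change_res -!map_mx_comp.
by congr (_ *m _); apply: eq_map_mx => a; rewrite /= ?ain_res ?ediff_res.
Qed.

Lemma conn_trace_res k (r : frame V) (p : 'I_k -> frame V) :
  ares La i (ctrace r p) =
  ctrace (restrict_triv i r) (fun l => restrict_triv i (p l)).
Proof.
rewrite /conn_trace -trace_map_mx rmorph_prod.
by congr (\tr _); apply: eq_bigr => l _; exact: connection_res.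
Qed.

End Restriction.

Variable k : nat.
Local Notation up l := (lift ord_max l).

Definition inv_fact (W : opens X) : La W :=
  ain La W (const_sec W (k.+1)`!%:R^-1).

Lemma inv_fact_res (V W : opens X) (i : W `<=` V) :
  ares La i (inv_fact V) = inv_fact W.
Proof. by rewrite /inv_fact ain_res const_sec_res. Qed.

(** The form [t] of the theorem, for [k+1] frames over one open set: the base
    of each term is the frame with the last index. *)
Definition frames_form (W : opens X) (P : 'I_k.+1 -> frame W) : La W :=
  inv_fact W *
  alt (fun s => ctrace (P (s ord_max)) (fun l : 'I_k => P (s (up l)))).

Lemma frames_form_res (V W : opens X) (i : W `<=` V)
    (P : 'I_k.+1 -> frame V) (P' : 'I_k.+1 -> frame W) :
  (forall a, restrict_triv i (P a) = P' a) ->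
  ares La i (frames_form P) = frames_form P'.
Proof.
move=> /funext <-; rewrite /frames_form rmorphM inv_fact_res; congr (_ * _).
by rewrite raddf_alt; apply: eq_alt => s; exact: conn_trace_res.
Qed.

(** With an arbitrary reference frame [q] in place of the varying base frame,
    the form becomes an alternating sum of monomials. *)
Lemma frames_formE (W : opens X) (q : frame W) (P : 'I_k.+1 -> frame W) :
  frames_form P =
  inv_fact W *
  (alt (fun s => \tr (\prod_(l < k) conn (P (s (up l))) q)) *+ k.+1).
Proof.
rewrite /frames_form; congr (_ * _).
under eq_alt do rewrite (conn_trace_change _ q).
have := alt_prod_diff (fun a => conn (P a) q).
by move=> /(congr1 mxtrace); rewrite raddf_alt raddfMn raddf_alt.
Qed.

Lemma frames_form_swap (W : opens X) (P : 'I_k.+1 -> frame W) (s : 'S_k.+1) :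
  frames_form (fun a => P (s a)) = frames_form P *~ (-1) ^+ s.
Proof.
rewrite /frames_form -mulrzAr; congr (_ * _).
rewrite /alt mulrz_suml (reindex_inj (mulIg s^-1%g)) /=.
apply: eq_bigr => t _; rewrite -mulrzA odd_permM odd_permV signr_addb.
have tE a : s ((t * s^-1)%g a) = t a by rewrite permM permKV.
by rewrite tE (_ : (fun l => _) = fun l => P (t (up l))) // funeqE => l; rewrite tE.
Qed.

Lemma frames_form_eq0 (W : opens X) (P : 'I_k.+1 -> frame W) (a b : 'I_k.+1) :
  a != b -> P a = P b -> frames_form P = 0.
Proof.
move=> ab Pab; rewrite /frames_form.
pose f (s : 'S_k.+1) := ctrace (P (s ord_max)) (fun l : 'I_k => P (s (up l))).
have PE c : P (tperm a b c) = P c by case: tpermP => [->|->|].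
rewrite -[alt _]/(alt f).
suff -> : alt f = 0 by rewrite mulr0.
have -> : alt f = alt (fun s => f s^-1%g).
  rewrite /alt (reindex_inj invg_inj) /=.
  by apply: eq_bigr => s _; rewrite odd_permV.
apply: (alt_tperm_inv ab) => s; rewrite invMg tpermV /f !permM PE.
rewrite (_ : (fun l => _) = fun l => P (s^-1%g (up l))) // funeqE => l.
by rewrite !permM PE.
Qed.

Section Transition.
Variables (U : open_cover X) (phi : forall i, trivialization E M (U i)).

Lemma inter_sub p (i : 'I_p.+1 -> cov_idx U) (a : 'I_p.+1) : inter i `<=` U (i a).
Proof. by move=> x; exact. Qed.

Lemma dlogE (i j : cov_idx U) (W : opens X) (h : W `<=` opens_setI (U i) (U j))
    (hi : W `<=` U i) (hj : W `<=` U j) :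
  dlog La phi h = conn (restrict_triv hi (phi i)) (restrict_triv hj (phi j)).
Proof.
rewrite /connection; have -> : dlog La phi h =
    map_mx (ain La W) (map_mx (rres O h) (gl_inv (transition phi i j))) *m
    map_mx (ediff La (W:=W)) (map_mx (rres O h) (transition phi i j)).
  by rewrite /dlog -!map_mx_comp.
by congr (_ *m _); congr (map_mx _ _); exact: change_res.
Qed.

Lemma tform_valE (i : 'I_k.+1 -> cov_idx U) :
  tform_val La phi i =
  frames_form (fun a => restrict_triv (@inter_sub k i a) (phi (i a))).
Proof.
rewrite /frames_form /alt mulr_sumr; apply: eq_bigr => s _.
have upE (l : 'I_k) : widen_ord (leqnSn k) l = up l.
  by apply: val_inj; rewrite [RHS]lift_max.
rewrite mulrzAr -mulrzAl; congr (_ * _).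
  rewrite /inv_fact /const_sec !rmorphM !rmorphXn !rmorphN !rmorph1.
  by rewrite mulr_sign -mulrzl rmorphXn rmorphN1 mulr_sign.
congr (\tr _); apply: eq_bigr => l _.
rewrite -upE; exact: dlogE.
Qed.

End Transition.
End Forms.

(** * Cocycle condition and homotopy *)

Section Homotopy.
Variables (K : fieldType) (X : scheme_over K).
Variables (Om : kaehler X) (La : exterior_algebra Om).
Variables (M : nat) (E : mod_sheaf (sch_O X)) (k : nat).
Local Notation O := (sch_O X).
Local Notation frame W := (trivialization E M W).
Local Notation conn := (@connection K X Om La M E _).
Local Notation ctrace := (@conn_trace K X Om La M E _ _).
Local Notation up l := (lift ord_max l).

Lemma sum_scaled (V : pzRingType) (c : V) (n p : nat) (e : 'I_p -> int)
    (F : 'I_p -> V) :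
  \sum_(m < p) (c * (F m *+ n)) *~ e m = c * ((\sum_(m < p) F m *~ e m) *+ n).
Proof.
rewrite -sumrMnl mulr_sumr; apply: eq_bigr => m _.
by rewrite -mulrzAr !pmulrn mulrzAC.
Qed.

(** The monomials have degree [k], so among [k+2] indices the last two,
    [up ord_max] and [ord_max], do not occur. *)
Lemma frames_form_cocycle (W : opens X) (P : 'I_k.+2 -> frame W) :
  \sum_(m < k.+2)
    frames_form La (fun a : 'I_k.+1 => P (lift m a)) *~ (-1) ^+ m = 0.
Proof.
pose q := P ord0.
pose f (u : 'I_k.+1 -> 'I_k.+2) := \tr (\prod_(l < k) conn (P (u (up l))) q).
under eq_bigr do rewrite (frames_formE _ q).
rewrite sum_scaled (alt_faces f).
rewrite (@alt_tperm_inv _ _ (up ord_max) ord_max) ?mul0rz ?mul0rn ?mulr0 //.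
  by rewrite eq_sym neq_lift.
move=> s; rewrite /f; congr (\tr _); apply: eq_bigr => l _; rewrite permM.
by rewrite tperm_up ?up_neq_max // neq_lift eq_sym.
Qed.

(** In the [j]-th summand the base frame is [Q (s j)]: the [j]-th factor is then
    the difference of the connections of [P (s j)] and [Q (s j)], and the other
    factors pass from [Q] to [P] at [j].  The factor [k.+1] is the one that
    [alt_prod_diff] produces, and the sign is that of [alt_faces]. *)
Definition homotopy_form (W : opens X) (P Q : 'I_k -> frame W) : La W :=
  inv_fact La k W *
  (alt (fun s : 'S_k => \sum_(j < k)
     ctrace (Q (s j)) (fun l => if (l < j)%N then Q (s l) else P (s l)))
   *+ k.+1 *~ (-1) ^+ k).

Lemma homotopy_form_res (V W : opens X) (i : W `<=` V)
    (P Q : 'I_k -> frame V) (P' Q' : 'I_k -> frame W) :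
  (forall a, restrict_triv i (P a) = P' a) ->
  (forall a, restrict_triv i (Q a) = Q' a) ->
  ares La i (homotopy_form P Q) = homotopy_form P' Q'.
Proof.
move=> /funext <- /funext <-.
rewrite /homotopy_form rmorphM inv_fact_res raddfMz raddfMn raddf_alt.
congr (_ * (_ *+ _ *~ _)); apply: eq_alt => s; rewrite raddf_sum.
apply: eq_bigr => j _; rewrite [LHS]conn_trace_res.
by congr (conn_trace _ _ _); apply: funext => l; case: ifP.
Qed.

Lemma homotopy_formE (W : opens X) (q : frame W) (P Q : 'I_k -> frame W) :
  homotopy_form P Q =
  inv_fact La k W *
  (alt (fun s : 'S_k => \tr (\sum_(j < k) \prod_(l < k)
     ((if (l < j)%N then conn (Q (s l)) q else conn (P (s l)) q) -
       conn (Q (s j)) q))) *~ (-1) ^+ k *+ k.+1).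
Proof.
rewrite /homotopy_form !pmulrn mulrzAC; congr (_ * (_ *~ _ *~ _)).
apply: eq_alt => s; rewrite raddf_sum; apply: eq_bigr => j _ /=.
rewrite (conn_trace_change _ q); congr (\tr _); apply: eq_bigr => l _.
by case: ifP.
Qed.

Lemma homotopy_form_faces (W : opens X) (P Q : 'I_k.+1 -> frame W) :
  \sum_(m < k.+1)
    homotopy_form (fun a : 'I_k => P (lift m a)) (fun a => Q (lift m a))
      *~ (-1) ^+ m =
  frames_form La P - frames_form La Q.
Proof.
pose q := Q ord0; pose x a := conn (P a) q; pose y a := conn (Q a) q.
pose f (u : 'I_k -> 'I_k.+1) := \tr (\sum_(j < k) \prod_(l < k)
  ((if (l < j)%N then y (u l) else x (u l)) - y (u j))).
under eq_bigr do rewrite (homotopy_formE q).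
rewrite sum_scaled !(frames_formE _ q) -mulrBr -mulrnBl; congr (_ * (_ *+ _)).
under eq_bigr do rewrite mulrzAC.
rewrite -mulrz_suml (alt_faces f) -mulrzA -expr2 sqrr_sign mulr1z.
have := alt_prod_homotopy x y.
by move=> /(congr1 mxtrace); rewrite raddfB !raddf_alt.
Qed.

Lemma homotopy_form_ext_pow (W : opens X) (P Q : 'I_k -> frame W) :
  ext_pow_pred k (homotopy_form P Q).
Proof.
have trP (r : frame W) (p : 'I_k -> frame W) : wedge_span k (ctrace r p).
  apply: wedge_span_sum => a; apply: wedge_span_prod => l.
  by exists (frame_change r (p l)), (frame_change (p l) r).
have trE (x : La W) : wedge_span k x -> wedge_span k (- x) by exact: wedge_span_opp.
apply/asboolP/wedge_span_ext_pow/wedge_span_scale.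
have sgnP (n : nat) (x : La W) : wedge_span k x -> wedge_span k (x *~ (-1) ^+ n).
  by rewrite -signr_odd; case: odd => // /trE; rewrite expr1 mulrN1z.
apply/sgnP; rewrite pmulrn -[_ *~ _]/(_ *+ _) -[k.+1]card_ord -sumr_const.
apply: wedge_span_sum => _; apply: wedge_span_sum => s; apply/sgnP.
by apply: wedge_span_sum => j; exact: trP.
Qed.
End Homotopy.

(** * Sorting permutations *)

Section Sorting.
Variables (d : Order.disp_t) (T : orderType d) (n : nat) (f : 'I_n -> T).

Definition increasing (g : 'I_n -> T) :=
  forall a b : 'I_n, (a < b)%N -> (g a < g b)%O.

Lemma sorting_perm_exists : injective f ->
  exists s : 'S_n, increasing (fun a => f (s a)).
Proof.
move=> f_inj; pose t := [tuple f i | i < n].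
have : perm_eq (sort <=%O t) t by rewrite perm_sort.
case/tuple_permP => s sE; exists s => a b ab.
have t_uniq : uniq t by rewrite map_inj_uniq ?enum_uniq.
have t_sorted : sorted <%O (sort <=%O t).
  by rewrite lt_sorted_uniq_le sort_uniq t_uniq sort_le_sorted.
have nE (c : 'I_n) : f (s c) = nth (f c) (sort <=%O t) c.
  by rewrite sE -tnth_nth !tnth_mktuple.
rewrite (nE a) (nE b) (set_nth_default (f b)) ?size_sort ?size_tuple //.
by rewrite (lt_sorted_ltn_nth _ t_sorted) // inE size_sort size_tuple.
Qed.

Lemma sorting_perm_uniq (s s' : 'S_n) : injective f ->
  increasing (fun a => f (s a)) -> increasing (fun a => f (s' a)) -> s = s'.
Proof.
have srt (u : 'S_n) : increasing (fun a => f (u a)) ->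
    sorted <%O [seq f (u a) | a <- enum 'I_n].
  move=> ui; rewrite sorted_map.
  have : sorted ltn (map val (enum 'I_n)) by rewrite val_enum_ord iota_ltn_sorted.
  by rewrite sorted_map; apply: sub_sorted => a b; exact: ui.
have mem (u : 'S_n) x : (x \in [seq f (u a) | a <- enum 'I_n]) = (x \in codom f).
  apply/mapP/codomP => [[a _ ->]|[a ->]]; first by exists (u a).
  by exists (u^-1%g a); rewrite ?mem_enum ?permKV.
move=> f_inj si si'; apply/permP => a; apply: f_inj.
have /eq_in_map : [seq f (s a) | a <- enum 'I_n] = [seq f (s' a) | a <- enum 'I_n].
  by apply: lt_sorted_eq; [exact: srt | exact: srt | move=> x; rewrite !mem].
by apply; rewrite mem_enum.
Qed.
End Sorting.

(** * Classes in Cech cohomology *)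

Section Cech.
Variables (X : topologicalType) (F : ab_presheaf X).

Lemma cech_dB (U : open_cover X) p (b b' : cochain F U p) i :
  cech_d (fun i => b i - b' i) i = cech_d b i - cech_d b' i.
Proof.
by rewrite /cech_d -sumrB; apply: eq_bigr => j _; rewrite raddfB mulrzBl.
Qed.

Lemma cech_dN (U : open_cover X) p (b : cochain F U p) i :
  cech_d (fun i => - b i) i = - cech_d b i.
Proof.
by rewrite /cech_d -sumrN; apply: eq_bigr => j _; rewrite raddfN mulNrz.
Qed.

Lemma cohomologous_sym (U : open_cover X) p (s t : cocycle F U p) :
  cohomologous s t -> cohomologous t s.
Proof.
case: p s t => [|p] s t; rewrite /cohomologous /=.
  by move=> st i; rewrite -opprB st oppr0.
by case=> b bE; exists (fun i => - b i) => i; rewrite cech_dN -bE opprB.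
Qed.

Lemma cohomologous_trans (U : open_cover X) p (s t u : cocycle F U p) :
  cohomologous s t -> cohomologous t u -> cohomologous s u.
Proof.
case: p s t u => [|p] s t u; rewrite /cohomologous /=.
  by move=> st tu i; rewrite -(subrK (sval t i) (sval s i)) -addrA st tu addr0.
move=> [b bE] [b' b'E]; exists (fun i => b i - (- b' i)) => i.
by rewrite cech_dB cech_dN -bE -b'E opprK addrA subrK.
Qed.

Lemma eq_class_eq (T : Type) (R : T -> T -> Prop) (a b : T) :
  (forall s t, R s t -> R t s) -> (forall s t u, R s t -> R t u -> R s u) ->
  R a b -> eq_class R a = eq_class R b.
Proof.
move=> Rsym Rtrans Rab; apply: eq_exist; apply: funext => c; apply: propext.
by split; apply: Rtrans => //; exact: Rsym.
Qed.

Lemma cech_to_lim_refines (U V : open_cover X) p (a : cechH F U p) (b : cechH F V p) :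
  refines_to (existT _ U a) (existT _ V b) -> cech_to_lim a = cech_to_lim b.
Proof.
move=> ab; apply: eq_class_eq; [exact: rst_sym | exact: rst_trans | exact: rst_step].
Qed.

End Cech.

Section ProductCover.
Variables (X : topologicalType) (U V : open_cover X).

(** Cochains live on increasing tuples of indices, whence the lexicographic
    order; the second projection need not be monotone for it. *)
Definition product_index :=
  (cov_idx U *lexi[cov_disp U] cov_idx V)%type.

Lemma product_cover_subproof x :
  exists i : product_index, (opens_setI (U i.1) (V i.2) : set X) x.
Proof.
by have [i Ui] := cov_cover U x; have [j Vj] := cov_cover V x; exists (i, j).
Qed.

Definition product_cover : open_cover X :=
  @OpenCover X _ product_index (fun i => opens_setI (U i.1) (V i.2))
    product_cover_subproof.

Definition product_fst : refinement product_cover U :=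
  @Refinement X product_cover U (fun i : product_index => i.1)
    (fun i => @subIsetl X (U i.1) (V i.2)).
Definition product_snd : refinement product_cover V :=
  @Refinement X product_cover V (fun i : product_index => i.2)
    (fun i => @subIsetr X (U i.1) (V i.2)).
End ProductCover.

Lemma ext_valMz (X : topologicalType) (O : ring_sheaf X) (F : mod_sheaf O)
    (A : exterior_algebra F) (k : nat) (U : opens X) (s : ext_pow_sec A k U)
    (n : int) :
  ext_val (s *~ n) = ext_val s *~ n.
Proof. exact: (raddfMz (\val : {additive ext_pow_sec A k U -> A U})). Qed.

Section Invariant.
Variables (K : fieldType) (X : scheme_over K).
Variables (Om : kaehler X) (La : exterior_algebra Om).
Variables (M : nat) (E : mod_sheaf (sch_O X)).

Lemma fhat_cocycle k (U : open_cover X) (phi : forall i, trivialization E M (U i)) :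
  is_cocycle (fhat La k phi).
Proof.
move=> i; apply: val_inj; rewrite raddf_sum /=.
rewrite -[RHS](frames_form_cocycle La
  (fun a => restrict_triv (@inter_sub _ _ _ k.+1 i a) (phi (i a)))).
apply: eq_bigr => m _; rewrite ext_valMz /= tform_valE; congr (_ *~ _).
by apply: frames_form_res => a; exact: restrict_triv_comp.
Qed.

(** On [k] indices the cochain is the homotopy form between the two families of
    frames. *)
Lemma fhat_cohomologous k (hk : (1 <= k)%N) (U : open_cover X)
    (phi psi : forall i, trivialization E M (U i)) :
  cohomologous (exist _ (fhat La k phi) (@fhat_cocycle k U phi))
    (exist _ (fhat La k psi) (@fhat_cocycle k U psi)).
Proof.
case: k hk => // p _; rewrite /cohomologous /=.
pose fr (chi : forall i, trivialization E M (U i)) q (i : 'I_q.+1 -> cov_idx U) a :=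
  restrict_triv (@inter_sub _ _ _ q i a) (chi (i a)).
exists (fun i => ExtPowSec (homotopy_form_ext_pow La (fr phi p i) (fr psi p i))) => i.
apply: val_inj; rewrite raddf_sum raddfB /= !tform_valE.
rewrite -homotopy_form_faces.
apply: eq_bigr => m _; rewrite ext_valMz /=; congr (_ *~ _).
by symmetry; apply: homotopy_form_res => a; exact: restrict_triv_comp.
Qed.

Definition pull_frames (W U : open_cover X) (tau : refinement W U)
    (phi : forall i, trivialization E M (U i)) (j : cov_idx W) :
    trivialization E M (W j) :=
  restrict_triv (@ref_sub _ _ _ tau j) (phi (tau j)).

Lemma restrict_triv_idx (U : open_cover X)
    (phi : forall i, trivialization E M (U i))
    (W : opens X) (i j : cov_idx U) (hi : W `<=` U i) (hj : W `<=` U j) :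
  i = j -> restrict_triv hi (phi i) = restrict_triv hj (phi j).
Proof. by move=> ij; subst j; rewrite (Prop_irrelevance hi hj). Qed.

(** Write [j = tau \o i].  If [j] is injective, exactly one permutation sorts it,
    and its sign is absorbed by the antisymmetry of [frames_form].  If [j] takes
    a value twice, no permutation sorts it strictly, and the form of a family
    with a repeated frame vanishes. *)
Lemma pullback_fhat k (W U : open_cover X) (tau : refinement W U)
    (phi : forall i, trivialization E M (U i)) i :
  fhat La k (pull_frames tau phi) i = pullback tau (fhat La k phi) i.
Proof.
rewrite /pullback /alt_ext raddf_sum.
set FN := fhat _ _ _ _.
have iU a : inter i `<=` U (tau (i a)).
  by move=> x ix; apply: ref_sub; exact: ix.
have FNE (s : 'S_k.+1) (h : is_incr (fun l => tau (i (s l)))) :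
    abres (ext_pow La k) (@inter_ref X W U tau k i)
      (abres (ext_pow La k) (@inter_perm X U k (fun l => tau (i l)) s)
        (fhat La k phi (Incr h)) *~ (-1) ^+ s) = FN.
  have ss : (-1) ^+ s * (-1) ^+ s = 1 :> int by rewrite -expr2 sqrr_sign.
  apply: val_inj; rewrite !raddfMz /FN /= !tform_valE.
  rewrite -[RHS]mulr1z -[X in _ = _ *~ X]ss mulrzA -frames_form_swap.
  congr (_ *~ _).
  pose N a := restrict_triv (@inter_sub _ _ U k (fun l => tau (i l)) a)
    (phi (tau (i a))).
  transitivity (ares La (@inter_ref X W U tau k i)
      (frames_form La (fun a => N (s a)))).
    congr (ares _ _ _); apply: frames_form_res => a.
    exact: restrict_triv_comp.
  apply: frames_form_res => a; symmetry.
  rewrite /N /pull_frames (restrict_triv_comp _ _ (iU (s a))).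
  by symmetry; exact: restrict_triv_comp.
have [tau_inj|] := pselect (injective (fun a => tau (i a))).
  have [r r_incr] := sorting_perm_exists tau_inj.
  rewrite (bigD1 r) //= big1 => [|t ts].
    by case: pselect => // h; rewrite addr0 FNE.
  case: pselect => [h|_]; last by rewrite raddf0.
  by case/eqP: ts; exact: (sorting_perm_uniq tau_inj h r_incr).
move=> /existsNP[a /existsNP[b /not_implyP[tab /eqP ab]]].
have FN0 : FN = 0.
  apply: val_inj; rewrite /= tform_valE.
  apply: (frames_form_eq0 _ ab).
  rewrite /pull_frames.
  rewrite (restrict_triv_comp _ _ (iU a)).
  rewrite (restrict_triv_comp _ _ (iU b)).
  exact: restrict_triv_idx.
rewrite FN0 big1 // => s _.
by case: pselect => [h|_]; [rewrite FNE | rewrite raddf0].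
Qed.

Lemma fhat_pull_lim k (W U : open_cover X) (tau : refinement W U)
    (phi : forall i, trivialization E M (U i)) :
  cech_to_lim (cech_class (@fhat_cocycle k U phi)) =
  cech_to_lim (cech_class (@fhat_cocycle k W (pull_frames tau phi))).
Proof.
apply: cech_to_lim_refines.
exists tau, (exist _ _ (@fhat_cocycle k U phi)),
  (exist _ _ (@fhat_cocycle k W (pull_frames tau phi))).
by split=> // i; exact: pullback_fhat.
Qed.

Lemma fhat_class_indep k (hk : (1 <= k)%N) (U : open_cover X)
    (phi psi : forall i, trivialization E M (U i)) :
  cech_class (@fhat_cocycle k U phi) = cech_class (@fhat_cocycle k U psi).
Proof.
apply: eq_class_eq; [exact: cohomologous_sym | exact: cohomologous_trans |].
exact: fhat_cohomologous.
Qed.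

End Invariant.

Theorem theorem1p16 (K : fieldType) (X : scheme_over K) (Om : kaehler X)
    (La : exterior_algebra Om) (k : nat) (hk : (1 <= k)%N)
    (hchar : forall p : nat, p \in [pchar K]%R -> ~~ (p %| (k.+2)`!)%N)
    (M : nat) (E : mod_sheaf (sch_O X)) (hE : locally_free M E) :
  exists hcoc : forall (U : open_cover X) (phi : forall i, trivialization E M (U i)),
      is_cocycle (fhat La k phi),
    (forall (U : open_cover X) (phi psi : forall i, trivialization E M (U i)),
        cech_class (hcoc U phi) = cech_class (hcoc U psi)) /\
    (forall (U V : open_cover X) (phi : forall i, trivialization E M (U i))
        (psi : forall i, trivialization E M (V i)),
        cech_to_lim (cech_class (hcoc U phi)) =
        cech_to_lim (cech_class (hcoc V psi))).
Proof.
exists (fun U phi => @fhat_cocycle _ _ _ La _ _ k U phi).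
split=> [U phi psi|U V phi psi].
  exact: fhat_class_indep.
rewrite (fhat_pull_lim La k (product_fst U V) phi).
rewrite (fhat_pull_lim La k (product_snd U V) psi).
by rewrite (fhat_class_indep La hk _ (pull_frames (product_snd U V) psi)).
Qed.
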